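(* Let $X$ be a Polish space, and $A\subseteq X^\omega$ an analytic (i.e. $\mathbf{\Sigma}^1_1$) set. Then exactly one of the following holds: (a) $[X,A]\preceq_{B}[\omega,\neg\Delta^\omega(\omega)]$. (b) $[\mathbb{G},\mathbb{A}_{\omega}\cap\mathbb{G}^\omega]\preceq_{c}[X,A]$.
   Context: Here $\omega=\{0,1,2,\dots\}$ carries the discrete topology and $\omega^\omega$ the product topology. $\omega^{<\omega}$ is the set of finite sequences of elements of $\omega$, $|s|$ is the length of $s$, juxtaposition denotes concatenation, $0^k$ is the sequence of $k$ zeros, and $s\subseteq\alpha$ means that $s$ is an initial segment of $\alpha$. For a set $Y$, $\Delta^\omega(Y):=\{(y_i)_{i\in\omega}\in Y^\omega\mid \forall i\in\omega\ \ y_i=y_0\}$, and $\neg\Delta^\omega(\omega):=\omega^\omega\setminus\Delta^\omega(\omega)$. For a map $u:X\to Y$, $u^\omega:X^\omega\to Y^\omega$ is defined by $u^\omega[(x_i)_{i\in\omega}]:=(u(x_i))_{i\in\omega}$. For Polish spaces $X,Y$ and $A\subseteq X^\omega$, $B\subseteq Y^\omega$, we write $[X,A]\preceq_B[Y,B]$ (resp. $[X,A]\preceq_c[Y,B]$) if there is a Borel (resp. continuous) map $u:X\to Y$ with $A\subseteq (u^\omega)^{-1}(B)$. Let $(p_n)_{n\in\omega}$ be the sequence of prime numbers, and define the injection $I:\omega^{<\omega}\to\omega$ by $I(\emptyset):=1$ and $I(s):=p_0^{s(0)+1}\cdots p_{|s|-1}^{s(|s|-1)+1}$ if $s\neq\emptyset$.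 Let $\varphi:I[\omega^{<\omega}]\to\omega$ be the increasing bijection, and $\psi_\omega:=(\varphi\circ I)^{-1}:\omega\to\omega^{<\omega}$, a bijection with $|\psi_\omega(n)|\le n$. Set $s^\omega_n:=\psi_\omega(n)0^{n-|\psi_\omega(n)|}$, a sequence of length $n$. Set $$\mathbb{A}_\omega:=\{(s^\omega_n i\gamma)_{i\in\omega}\mid n\in\omega,\ \gamma\in\omega^\omega\}\subseteq(\omega^\omega)^\omega,$$ $$\mathbb{G}:=\{\alpha\in\omega^\omega\mid\forall m\in\omega\ \exists n\geq m\ \ s^\omega_n0\subseteq\alpha\},$$ the latter being a dense $G_\delta$ subset of $\omega^\omega$ (hence a Polish space with the subspace topology). *)

(* Defs.v *)
From HB Require Import structures.
From mathcomp Require Import all_boot all_order all_algebra.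
From mathcomp Require Import all_classical all_reals all_analysis.

Set Implicit Arguments.
Unset Strict Implicit.
Unset Printing Implicit Defensive.

Local Open Scope classical_set_scope.

(* The library's [completeType] is pointed, whereas a Polish space may be empty;
   hence completeness is spelled out. *)
Definition complete_metric (R : realType) (M : metricType R) : Prop :=
  forall u : nat -> M, cauchy (u @ \oo) -> exists x : M, u @ \oo --> x.

Definition completely_metrizable (R : realType) (X : topologicalType) : Prop :=
  exists (M : metricType R) (f : X -> M) (g : M -> X),
    [/\ complete_metric M, continuous f, continuous g, cancel f g
      & cancel g f].

Definition separable (X : topologicalType) : Prop :=
  exists2 D : set X, countable D & dense D.

Definition polish (R : realType) (X : topologicalType) : Prop :=
  separable X /\ completely_metrizable R X.

(* The empty set is analytic, being the image of the empty Polish space. *)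
Definition analytic (R : realType) (X : topologicalType) (A : set X) : Prop :=
  exists (Y : topologicalType) (f : Y -> X),
    [/\ polish R Y, continuous f & range f = A].

Definition borel (X : topologicalType) : set (set X) := <<s @open X >>.

Definition borel_map (X Y : topologicalType) (u : X -> Y) : Prop :=
  forall B : set Y, borel B -> borel (u @^-1` B).

Notation "X ^ω" := {ptws nat -> X} (at level 2, format "X ^ω") : type_scope.

Definition map_omega (X Y : Type) (u : X -> Y) (x : X^ω) : Y^ω :=
  fun i => u (x i).

Definition diag_omega (Y : Type) : set (Y^ω) := [set y | forall i, y i = y 0].

Definition borel_le (X Y : topologicalType) (A : set (X^ω)) (B : set (Y^ω)) :
    Prop :=
  exists u : X -> Y, borel_map u /\ A `<=` map_omega u @^-1` B.

Definition continuous_le (X Y : topologicalType) (A : set (X^ω))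
    (B : set (Y^ω)) : Prop :=
  exists u : X -> Y, continuous u /\ A `<=` map_omega u @^-1` B.

Lemma ex_prime_above (m : nat) : exists p, (m < p) && prime p.
Proof. by have [p mp pp] := prime_above m; exists p; rewrite mp. Qed.

Definition next_prime (m : nat) : nat := ex_minn (ex_prime_above m).

(* [nth_prime 0 = 2], [nth_prime 1 = 3], ... *)
Definition nth_prime (n : nat) : nat := iter n.+1 next_prime 0.

Lemma next_prime_gt m : m < next_prime m.
Proof. by rewrite /next_prime; case: ex_minnP => p /andP[]. Qed.

Lemma nth_prime_prime n : prime (nth_prime n).
Proof. by rewrite /nth_prime /= /next_prime; case: ex_minnP => p /andP[]. Qed.

Lemma nth_prime_mono : {mono nth_prime : m n / m < n}.
Proof. exact: leqW_mono (leq_mono (homo_ltn ltn_trans (fun=> next_prime_gt _))). Qed.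

Lemma nth_prime_inj : injective nth_prime.
Proof. exact: incn_inj (leq_mono (homo_ltn ltn_trans (fun=> next_prime_gt _))). Qed.

Definition seq_code (s : seq nat) : nat :=
  \prod_(i < size s) nth_prime i ^ (nth 0 s i).+1.

Lemma seq_code_gt0 s : 0 < seq_code s.
Proof. by apply: prodn_gt0 => i; rewrite expn_gt0 prime_gt0 ?nth_prime_prime. Qed.

Lemma logn_seq_code s i :
  logn (nth_prime i) (seq_code s) = if i < size s then (nth 0 s i).+1 else 0.
Proof.
have lognE j e : logn (nth_prime i) (nth_prime j ^ e) = (i == j) * e.
  by rewrite lognX logn_prime ?nth_prime_prime// (inj_eq nth_prime_inj) mulnC.
rewrite /seq_code -(big_mkord predT (fun i => nth_prime i ^ (nth 0 s i).+1)).
elim: (size s) => [|n IHn]; first by rewrite big_geq ?logn1.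
have pos k : 0 < nth_prime k ^ (nth 0 s k).+1.
  by rewrite expn_gt0 prime_gt0 ?nth_prime_prime.
rewrite big_nat_recr//= lognM// ?prodn_gt0// IHn lognE ltnS [i <= n]leq_eqVlt.
by case: (eqVneq i n) => [->|_]; rewrite ?ltnn ?mul1n ?mul0n ?addn0 ?add0n.
Qed.

Lemma seq_code_inj : injective seq_code.
Proof.
move=> s t st.
have e i : (if i < size s then (nth 0 s i).+1 else 0) =
           (if i < size t then (nth 0 t i).+1 else 0).
  by rewrite -!logn_seq_code st.
have st_size : size s = size t.
  apply/eqP; rewrite eqn_leq; apply/andP; split; rewrite leqNgt; apply/negP => h.
    by have := e (size t); rewrite h ltnn.
  by have := e (size s); rewrite h ltnn.
apply: (@eq_from_nth _ 0) => // i si.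
by have := e i; rewrite -st_size si => -[].
Qed.

Lemma seq_code_rcons s x : seq_code s < seq_code (rcons s x).
Proof.
rewrite {2}/seq_code size_rcons big_ord_recr/=.
rewrite (eq_bigr (fun i : 'I__ => nth_prime i ^ (nth 0 s i).+1)); last first.
  by move=> i _; rewrite nth_rcons ltn_ord.
rewrite ltn_Pmulr ?seq_code_gt0//.
by rewrite -(exp1n (nth 0 (rcons s x) (size s)).+1) ltn_exp2r ?prime_gt1 ?nth_prime_prime.
Qed.

(* The increasing bijection from [range seq_code] onto [nat]: the rank of [m]
   in [range seq_code]; see [code_rank_mono], [code_rank_surj]. *)
Definition code_rank (m : nat) : nat :=
  count (fun k => k \in range seq_code) (iota 0 m).

Lemma code_rankS m : code_rank m.+1 = code_rank m + (m \in range seq_code).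
Proof. by rewrite /code_rank -addn1 iotaD count_cat/= addn0. Qed.

Lemma code_rank_mono :
  {in range seq_code &, {mono code_rank : m n / m < n}}.
Proof.
have hom m n : m \in range seq_code -> m < n -> code_rank m < code_rank n.
  move=> mI; elim: n => // n IHn; rewrite ltnS leq_eqVlt code_rankS.
  by case/predU1P => [<-|/IHn mn]; [rewrite mI addn1|exact: ltn_addr].
move=> m n mI nI; case: (ltngtP m n) => [/hom -> //|/hom nm|->].
  by rewrite ltnNge ltnW// nm.
by rewrite ltnn.
Qed.

Lemma code_rank_surj n : exists s, code_rank (seq_code s) = n.
Proof.
elim: n => [|n [s sn]].
  exists [::]; rewrite /seq_code big_ord0 (code_rankS 0).
  by case: (boolP (0 \in range seq_code)) => // /set_mem[t _ /eqP];
    rewrite eqn0Ngt seq_code_gt0.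
have ex : exists m, (seq_code s < m) && (m \in range seq_code).
  exists (seq_code (rcons s 0)); rewrite seq_code_rcons; apply/mem_set.
  by exists (rcons s 0).
case: (ex_minnP ex) => m /andP[sm /set_mem[t _ tm]] min_m.
exists t; rewrite tm.
have {}min_m k : seq_code s < k < m -> k \in range seq_code = false.
  move=> /andP[sk km]; apply/negP => kI; move: km.
  by rewrite ltnNge min_m// sk.
have : forall k, seq_code s < k <= m -> code_rank k = n.+1.
  elim=> // k IHk /andP[]; rewrite ltnS leq_eqVlt => /predU1P[<- _|sk km].
    by rewrite code_rankS sn mem_set ?addn1//; exists s.
  by rewrite code_rankS IHk ?sk 1?ltnW// min_m ?addn0// sk.
by apply; rewrite sm leqnn.
Qed.

(* The inverse of [code_rank \o seq_code]; see [seq_of_natK], [nat_of_seqK]. *)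
Definition psi_omega (n : nat) : seq nat :=
  xget [::] [set s | code_rank (seq_code s) = n].

Lemma seq_of_natK n : code_rank (seq_code (psi_omega n)) = n.
Proof.
rewrite /psi_omega; case: xgetP => [s _ //|noS].
by have [s sn] := code_rank_surj n; case: (noS s).
Qed.

Lemma nat_of_seqK s : psi_omega (code_rank (seq_code s)) = s.
Proof.
have := seq_of_natK (code_rank (seq_code s)); set t := psi_omega _ => ts.
have I u : seq_code u \in range seq_code by apply/mem_set; exists u.
apply: seq_code_inj; case: (ltngtP (seq_code t) (seq_code s)) => //;
  by rewrite -(code_rank_mono (I _) (I _)) ts ltnn.
Qed.

Lemma size_psi_omega n : size (psi_omega n) <= n.
Proof.
rewrite -[leqRHS]seq_of_natK; elim/last_ind: (psi_omega n) => // s x IHs.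
have I u : seq_code u \in range seq_code by apply/mem_set; exists u.
by rewrite size_rcons (leq_ltn_trans IHs)// code_rank_mono// seq_code_rcons.
Qed.

Definition s_omega (n : nat) : seq nat :=
  psi_omega n ++ nseq (n - size (psi_omega n)) 0.

Lemma size_s_omega n : size (s_omega n) = n.
Proof. by rewrite size_cat size_nseq subnKC// size_psi_omega. Qed.

Definition cat_omega (s : seq nat) (gamma : nat^ω) : nat^ω :=
  fun k => if k < size s then nth 0 s k else gamma (k - size s).

Definition prefix_omega (s : seq nat) (alpha : nat^ω) : Prop :=
  forall k, k < size s -> nth 0 s k = alpha k.

Definition A_omega : set ((nat^ω)^ω) :=
  [set x | exists (n : nat) (gamma : nat^ω),
     x = (fun i => cat_omega (rcons (s_omega n) i) gamma)].

Definition G_omega : set (nat^ω) :=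
  [set alpha | forall m, exists2 n, m <= n &
     prefix_omega (rcons (s_omega n) 0) alpha].

(* [A_omega] intersected with the power of [G_omega], seen inside the power of
   the subspace [set_type G_omega]. *)
Definition A_omega_G : set ((set_type G_omega)^ω) :=
  map_omega (@set_val _ G_omega) @^-1` A_omega.

(* Main.v *)
Require Import Defs.
From HB Require Import structures.
From mathcomp Require Import all_boot all_order all_algebra.
From mathcomp Require Import all_classical all_reals all_analysis.

(** Alternative (a) says that [X] is covered by countably many Borel sets that
    are independent, i.e. whose powers miss [A].

    The alternatives exclude each other by Baire category
    ([not_coloring_and_homomorphism]).  Composing the two maps colours [G_omega]
    with countably many colours, each colour class having the Baire property.
    Since [G_omega] is comeager, some class is comeager in a basic open set, and
    this set contains the one given by some [s_omega n].  Then for comeager many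
    [gamma] the points [s_omega n ++ i ++ gamma], for all [i] at once, lie in
    [G_omega] and in that class: a monochromatic element of [A_omega_G].

    For the existence part, let [A] be the range of a continuous [f : Y -> X^ω].
    A configuration of level [n] is an approximate homomorphism: it places the
    sequences of length [n] in [X], and for each [k < n] and each tail [t] it
    gives a point of [Y] whose image by [f] lists the places of
    [s_omega k ++ i ++ t], for [i] in [nat].  A set of configurations is small
    if countably many conditions `the vertex [t] is in the Borel independent
    set [B]' cover it.  If all configurations of level 0 form a small set, then
    (a) holds ([small_coloring]).  Otherwise one builds large sets of
    configurations of each level.  The main step ([extend_large]) takes [H]
    large at level [n] and joins, in all possible ways, countably many members
    of [H] along an edge at [s_omega n].  If the result were covered by
    conditions [t k], [B k], remove from [H] the configurations that satisfy one
    of these at the corresponding vertex of level [n].  What is left of [H] is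
    still large, so the places that it gives to [s_omega n] are not included in
    a Borel independent set.  They form an analytic set, hence they are not
    independent either ([independent_borel_hull]), so members of what is left
    can be joined; but the joined configuration satisfies none of the
    conditions.

    Between two extensions one passes to a large piece on which finitely many
    coordinates are localized in small closed sets: the vertex
    [s_omega n ++ 0], and the edges that contain it.  This is possible
    because smallness is preserved by countable unions; infinitely many
    coordinates cannot be localized at once, which is why the limit is defined
    on [G_omega] only.  Along a point of [G_omega] the localized vertices recur
    infinitely often, so the places of its initial segments converge.  This
    defines the continuous homomorphism of (b) ([stages_homomorphism]). *)

Set Implicit Arguments.
Unset Strict Implicit.
Unset Printing Implicit Defensive.

Import Order.TTheory GRing.Theory Num.Theory.
Local Open Scope classical_set_scope.

(** * Complete sequences of closed covers *)

Definition cell (Q : Type) (U : nat -> nat -> set Q) (j : nat -> nat) (n : nat)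
  : set Q := [set q | forall m, m < n -> U m (j m) q].

(** In a complete separable metric space, take for [U m] the closed balls of
    radius [1 / (m + 1)] around the points of a countable dense set.  Everything
    that completeness and separability are used for follows from these four
    properties, which pass without any metric to countable products and closed
    subsets. *)
Record complete_sieve (X : topologicalType) (U : nat -> nat -> set X) : Prop :=
  CompleteSieve {
  sieve_closed : forall m j, closed (U m j);
  sieve_cover : forall m x, exists j, U m j x;
  sieve_point : forall j, (forall n, cell U j n !=set0) ->
    exists x, forall m, U m (j m) x;
  sieve_nbhs : forall j x W, (forall m, U m (j m) x) -> nbhs x W ->
    exists n, cell U j n `<=` W
}.

Lemma near_cell (Q : Type) (U : nat -> nat -> set Q) (j : nat -> nat)
    (u : nat -> Q) n :
  (forall m, \forall k \near \oo, U m (j m) (u k)) ->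
  \forall k \near \oo, cell U j n (u k).
Proof.
move=> uU; elim: n => [|n IHn]; first by apply: nearW => k m.
have uUn := uU n; near=> k => m; rewrite ltnS leq_eqVlt => /predU1P[->|].
  by near: k.
by move: m; near: k.
Unshelve. all: by end_near. Qed.

Lemma sieve_cvg (X : topologicalType) (U : nat -> nat -> set X) :
  complete_sieve U -> forall (j : nat -> nat) (u : nat -> X),
  (forall m, \forall n \near \oo, U m (j m) (u n)) ->
  exists2 x, forall m, U m (j m) x & u @ \oo --> x.
Proof.
move=> sU j u uU.
have [n|x xU] := sieve_point sU (j := j).
  by have /filter_ex[k ?] := near_cell n uU; exists (u k).
exists x => // W /(sieve_nbhs sU xU)[n cW].
by apply: filterS (near_cell n uU) => k /cW.
Qed.

Section polish.
Context {R : realType} {X : topologicalType}.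
Hypothesis polX : polish R X.
Local Open Scope ring_scope.

Lemma polish_hausdorff : hausdorff_space X.
Proof.
case: polX => _ [M [f [g [_ cf _ fK _]]]] x y xy.
apply: (can_inj fK); apply: (@metric_hausdorff R M) => A B xA yB.
have [z [Az Bz]] := xy _ _ (cf x _ xA) (cf y _ yB).
by exists (f z).
Qed.

Lemma closure_ball (M : pseudoMetricType R) (c z : M) (r : R) :
  0 < r -> closure (ball c r) z -> ball c (r + r) z.
Proof.
move=> r0 /(_ _ (nbhsx_ballx z r r0))[w [cw /ball_sym zw]].
exact: ball_triangle cw zw.
Qed.

(** The pieces are taken as preimages of closures rather than balls because the
    limit of a sequence that stays in a piece has to remain in it. *)
Lemma polish_sieve : exists U : nat -> nat -> set X, complete_sieve U.
Proof.
case: polX => -[D cD dD] [M [f [g [cM cf cg fK gK]]]].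
have /countable_injP[c cinj] := cD.
pose r (m : nat) : R := m.+1%:R^-1.
have r0 m : 0 < r m by rewrite invr_gt0 ltr0n.
(* The index of a piece determines its centre, as [c] is injective on [D]. *)
pose B m j := [set z : M | exists d, [/\ D d, c d = j & ball (f d) (r m) z]].
pose U m j := f @^-1` closure (B m j).
have BE m d : D d -> B m (c d) = ball (f d) (r m).
  move=> Dd; apply/seteqP; split => [z [e [De ed]]|z zd]; last by exists d.
  by have -> : e = d by apply: cinj => //; rewrite inE.
have UP m j x : U m j x -> exists2 d, D d /\ c d = j & ball (f d) (r m + r m) (f x).
  rewrite /U/= => xB.
  have [_ [[d [Dd dj _]] _]] := xB _ (nbhsx_ballx (f x) 1 ltr01).
  by exists d => //; move: xB; rewrite -dj BE//; apply: closure_ball.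
have Uclose m j x y : U m j x -> U m j y -> ball (f x) (r m *+ 4) (f y).
  move=> /UP[d [Dd dj] dx] /UP[e [De ej] ey].
  have {De ej} {}ey : ball (f d) (r m + r m) (f y).
    by rewrite (_ : d = e)//; apply: cinj; rewrite ?inE// dj ej.
  by rewrite (_ : _ *+ 4 = (r m + r m) + (r m + r m));
    [exact: ball_triangle (ball_sym dx) ey|rewrite -!mulr2n -mulrnA].
have small e : 0 < e -> exists m, r m *+ 4 < e.
  move=> e0; have e40 : 0 < e / 4 by rewrite divr_gt0.
  have [m _ /(_ m (leqnn _)) me] := near_infty_natSinv_lt (PosNum e40).
  by exists m; rewrite -mulr_natr -ltr_pdivlMr.
have Ucl m j : closed (U m j).
  by apply: preimage_closed => [x _|]; [exact: cf|exact: closed_closure].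
exists U; split => //.
- move=> m x.
  have [||y [fxy Dy]] := dD (f @^-1` (interior (ball (f x) (r m)))).
  + by exists x; apply: nbhsx_ballx; exact: r0.
  + by apply: open_comp => [z _|]; [exact: cf|exact: open_interior].
  exists (c y); rewrite /U/= BE//; apply: subset_closure.
  by apply: ball_sym; exact: interior_subset fxy.
- move=> j /choice[u uP].
  have [|z uz] := cM (f \o u).
    apply: cauchy_exP => e e0; have [m me] := small e e0.
    exists (f (u m.+1)); exists m.+1 => // n /= mn.
    apply: le_ball (ltW me) _ _; apply: (Uclose _ (j m)); exact: uP.
  exists (g z) => m; rewrite /U/= gK.
  apply: (@closed_cvg _ _ \oo _ (f \o u)) => //; first exact: closed_closure.
  by exists m.+1 => // n /= mn; exact: uP.
- move=> j x W xU xW.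
  have : nbhs (f x) (g @^-1` W) by apply: cg; rewrite fK.
  move=> /nbhs_ballP[e /= e0 eW]; have [m me] := small e e0.
  exists m.+1 => y /(_ m (ltnSn m)) ym.
  rewrite -[y]fK; apply: eW; apply: le_ball (ltW me) _ _.
  exact: Uclose ym.
Qed.

End polish.

(** * Borel sets as projections *)

(** Dependent choice along a tree of finite sequences. *)
Lemma tree_branch (T : Type) (P : seq T -> Prop) : P [::] ->
  (forall s, P s -> exists j, P (rcons s j)) ->
  exists a : nat -> T, forall n, P (mkseq a n).
Proof.
move=> P0 PS; pose next_ (s : {s | P s}) := cid (PS _ (svalP s)).
pose next s : {s | P s} := exist _ (rcons (sval s) (sval (next_ s))) (svalP (next_ s)).
pose st n := iter n next (exist _ [::] P0).
exists (fun n => sval (next_ (st n))) => n.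
suff -> : mkseq (fun n => sval (next_ (st n))) n = sval (st n) by exact: svalP.
by elim: n => // n IHn; rewrite mkseqS IHn.
Qed.

Lemma cell_mkseq (Q : Type) (U : nat -> nat -> set Q) j n :
  cell U (nth 0 (mkseq j n)) n = cell U j n.
Proof.
by apply/seteqP; split => q qU m mn; have := qU m mn; rewrite nth_mkseq.
Qed.

Lemma ptws_eval_nbhs (X : topologicalType) (x : X^ω) (i : nat) (W : set X) :
  nbhs (x i) W -> nbhs x [set y : X^ω | W (y i)].
Proof. exact: (@proj_continuous nat (fun=> X) i x). Qed.

Section borel.
Context {X : topologicalType}.
Implicit Types (B : set X) (F : nat -> set X).

Lemma borel_open B : open B -> borel B.
Proof. exact: (@sub_sigma_algebra X setT open). Qed.

Lemma borel0 : borel (@set0 X).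
Proof. exact: (@sigma_algebra0 X setT open). Qed.

Lemma borelC B : borel B -> borel (~` B).
Proof. by rewrite -setTD => bB; exact: (@sigma_algebraCD X setT open). Qed.

Lemma borelT : borel [set: X].
Proof. by rewrite -setC0; apply: borelC; exact: borel0. Qed.

Lemma borel_bigcup F : (forall n, borel (F n)) -> borel (\bigcup_n F n).
Proof. exact: (@sigma_algebra_bigcup X setT open). Qed.

Lemma borel_bigcap F : (forall n, borel (F n)) -> borel (\bigcap_n F n).
Proof.
move=> bF; rewrite -[X in borel X]setCK setC_bigcap; apply: borelC.
by apply: borel_bigcup => n; exact: borelC.
Qed.

Lemma borel_ind (P : set X -> Prop) : (forall B, open B -> P B) ->
  (forall B, P B -> P (~` B)) ->
  (forall F, (forall n, P (F n)) -> P (\bigcup_n F n)) ->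
  forall B, borel B -> P B.
Proof.
move=> Po PC PU B; apply: (smallest_sub (X := P)); last exact: Po.
split => [|A PA|]; [exact/Po/open0|by rewrite setTD; exact: PC|exact: PU].
Qed.
End borel.

Section projection.
Context {X : topologicalType}.

(** Closedness in the product of [X] with the Baire space, in terms of
    sequences. *)
Definition seq_closed2 (C : X -> (nat -> nat) -> Prop) :=
  forall x_ x y_ y, x_ @ \oo --> x ->
    (forall k, \forall n \near \oo, y_ n k = y k) ->
    (\forall n \near \oo, C (x_ n) (y_ n)) -> C x y.

Definition projective (E : set X) := exists C, seq_closed2 C /\
  forall x, E x <-> exists y, C x y.

Lemma projective_closed E : closed E -> projective E.
Proof.
move=> cE; exists (fun x _ => E x); split.
  by move=> x_ x y_ y xx yy EX; exact: (closed_cvg _ cE EX _ xx).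
by move=> x; split => [Ex|[_]//]; exists (fun=> 0).
Qed.

(** An open set is the union of the cells that it includes; the projected
    variable names such a cell. *)
Lemma projective_open (U : nat -> nat -> set X) E :
  complete_sieve U -> open E -> projective E.
Proof.
move=> sU oE; pose dec k : seq nat := odflt [::] (unpickle k).
pose D k := cell U (nth 0 (dec k)) (size (dec k)).
exists (fun x y => D (y 0) `<=` E /\ D (y 0) x); split.
  move=> x_ x y_ y xx yy Dn.
  have {}Dn : \forall n \near \oo, D (y 0) `<=` E /\ D (y 0) (x_ n).
    by near=> n; rewrite -(near (yy 0) n)//; near: n.
  split; first by have /filter_ex[n []] := Dn.
  move=> m mk; apply: (closed_cvg _ (@sieve_closed _ _ sU m _) _ _ xx).
  by apply: filterS Dn => n [_ ]; apply.
move=> x; split => [Ex|[y [sE /sE]]//].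
have [j jx] := choice (fun m => sieve_cover sU m x).
have [n nE] := sieve_nbhs sU jx (open_nbhs_nbhs (conj oE Ex)).
exists (fun=> pickle (mkseq j n)).
rewrite /D /dec pickleK/= size_mkseq cell_mkseq; split => // m _; exact: jx.
Unshelve. all: by end_near. Qed.

Lemma projective_bigcup (F : nat -> set X) :
  (forall n, projective (F n)) -> projective (\bigcup_n F n).
Proof.
move=> /choice[C /all_and2[cC FC]].
exists (fun x y => C (y 0) x (fun k => y k.+1)); split.
  move=> x_ x y_ y xx yy Cn; apply: (cC _ _ _ (fun n k => y_ n k.+1) _ xx).
    by move=> k; exact: yy.
  by near=> n; rewrite -(near (yy 0) n)//; near: n.
move=> x; split => [[n _ /FC[y Cy]]|[y Cy]].
  by exists (fun k => if k is k'.+1 then y k' else n).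
by exists (y 0) => //; apply/FC; exists (fun k => y k.+1).
Unshelve. all: by end_near. Qed.

(** One projected sequence encodes the witnesses for all [n]. *)
Lemma projective_bigcap (F : nat -> set X) :
  (forall n, projective (F n)) -> projective (\bigcap_n F n).
Proof.
move=> /choice[C /all_and2[cC FC]].
exists (fun x y => forall n, C n x (fun k => y (pickle (n, k)))); split.
  move=> x_ x y_ y xx yy Cn i.
  apply: (cC _ _ _ (fun n k => y_ n (pickle (i, k))) _ xx).
    by move=> k; exact: yy.
  by apply: filterS Cn => n; exact.
move=> x; split => [Fx|[y Cy] n _]; last by apply/FC; eexists; exact: Cy.
have /choice[y yC] : forall n, exists y, C n x y by move=> n; apply/FC/Fx.
exists (fun m => if unpickle m is Some (n, k) then y n k else 0) => n.
by under eq_fun do rewrite pickleK.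
Qed.

(** The sets that are projections together with their complements form a
    sigma-algebra, since projections are preserved by countable unions and
    intersections. *)
Lemma borel_projective (U : nat -> nat -> set X) E :
  complete_sieve U -> borel E -> projective E.
Proof.
move=> sU bE; suff [] : projective E /\ projective (~` E) by [].
apply: (borel_ind (P := fun E => projective E /\ projective (~` E))) bE
  => [B oB|B [PB PCB]|F PF].
- by split; [exact: projective_open sU oB|exact/projective_closed/open_closedC].
- by rewrite setCK.
- split; first by apply: projective_bigcup => n; case: (PF n).
  by rewrite setC_bigcup; apply: projective_bigcap => n; case: (PF n).
Qed.
End projection.

(** [S] contains the limits of [rho] along the branches of a sequence of covers
    of [Q]: up to coding, [S] is a continuous image of a closed subset of the
    Baire space.  Only the images [rho q] need a topology. *)
Definition souslin (Z : topologicalType) (S : set Z) :=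
  exists (Q : Type) (rho : Q -> Z) (V : nat -> nat -> set Q),
  [/\ S `<=` range rho, forall m q, exists j, V m j q &
      forall j, (forall n, cell V j n !=set0) ->
        exists2 z, S z & forall W, nbhs z W ->
          exists n, forall q, cell V j n q -> W (rho q)].

Lemma analytic_souslin (R : realType) (Z : topologicalType) (S : set Z) :
  analytic R S -> souslin S.
Proof.
case=> Y [f [polY cf <-]]; have [U sU] := polish_sieve polY.
exists Y, f, U; split => //; first exact: sieve_cover.
move=> j /(sieve_point sU)[y yU]; exists (f y); first by exists y.
by move=> W /cf/(sieve_nbhs sU yU).
Qed.

Definition independent (X : topologicalType) (A : set (X^ω)) (S : set X) :=
  forall x, A x -> ~ forall i, S (x i).

Section separation.
Context {X : topologicalType} {QA QS : Type}.
Variables (f : QA -> nat -> X) (g : QS -> X).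
Implicit Types (DA : set QA) (DS : nat -> set QS).

(** The failure of this relation is what is propagated along a branch in the
    proof of the separation theorem below. *)
Definition separated DA DS := exists B : nat -> set X,
  [/\ forall i, borel (B i), forall i q, DS i q -> B i (g q) &
      forall a, DA a -> ~ forall i, B i (f a i)].

Lemma separatedS DA DA' DS DS' : DA `<=` DA' ->
  (forall i, DS i `<=` DS' i) -> separated DA' DS' -> separated DA DS.
Proof.
move=> sA sS [B [bB SB AB]]; exists B; split => // [i q /sS|a /sA]; last exact: AB.
exact: SB.
Qed.

Lemma separated_splitA (W : nat -> set QA) DA DS : (forall a, exists j, W j a) ->
  (forall j, separated (DA `&` W j) DS) -> separated DA DS.
Proof.
move=> cW /choice[B sB]; exists (fun i => \bigcap_j B j i); split.
- by move=> i; apply: borel_bigcap => j; case: (sB j).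
- by move=> i q Dq j _; case: (sB j) => _ + _; exact.
- move=> a Da aB; have [j aj] := cW a; case: (sB j) => _ _ /(_ a (conj Da aj)).
  by apply => i; exact: aB.
Qed.

(** The entry [i0] being in the piece [j] is not known in advance, hence a union
    over [j] for that entry and an intersection for all the others. *)
Lemma separated_splitS (W : nat -> set QS) i0 DA DS :
  (forall q, exists j, W j q) ->
  (forall j, separated DA
     (fun i => if i == i0 then DS i `&` W j else DS i)) ->
  separated DA DS.
Proof.
move=> cW /choice[B sB].
exists (fun i => if i == i0 then \bigcup_j B j i else \bigcap_j B j i); split.
- move=> i; case: ifP => _; [apply: borel_bigcup|apply: borel_bigcap] => j;
  by case: (sB j).
- move=> i q Dq; case: ifPn => [ii|/negPf ii].
    have [j qj] := cW q; exists j => //; case: (sB j) => _ /(_ i q) + _.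
    by rewrite ii; exact.
  by move=> j _; case: (sB j) => _ /(_ i q) + _; rewrite ii; exact.
- move=> a Da aB; have := aB i0; rewrite eqxx => -[j _ aj].
  case: (sB j) => _ _ /(_ a Da); apply => i; have := aB i.
  by case: eqVneq => [->|_ /(_ j)] //; exact.
Qed.
End separation.

(** Novikov's separation argument for infinitely many sets.  If no Borel box
    separates the power of [S] from [A], refine the covers one at a time, in an
    order that visits every cover of each of the countably many factors, and
    keep pieces that cannot be separated.  The limits are an element [z] of [A]
    and points [w i] of [S].  As [S] is independent, [z i <> w i] for some [i],
    and two disjoint open sets around these points separate all late pieces, a
    contradiction. *)
Theorem independent_borel_hull (X : topologicalType) (A : set (X^ω)) (S : set X) :
  hausdorff_space X -> souslin A -> souslin S -> independent A S ->
  exists B, [/\ borel B, S `<=` B & independent A B].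
Proof.
move=> hX [QA [f [VA [Af cVA limA]]]] [QS [g [VS [Sg cVS limS]]]] indS.
pose addr m : option (option nat * nat) := unpickle m.
pose code (c : option nat) (l : nat) := pickle (c, l).
have codeK c l : addr (code c l) = Some (c, l) by exact: pickleK.
pose boxA (s : seq nat) := [set q | forall m l, m < size s ->
  addr m = Some (None, l) -> VA l (nth 0 s m) q].
pose boxS (s : seq nat) i := [set q | forall m l, m < size s ->
  addr m = Some (Some i, l) -> VS l (nth 0 s m) q].
(* The intersection of the sides of a separating box is the hull. *)
have [[B [bB SB AB]]|nsep] := pselect (separated f g (boxA [::]) (boxS [::])).
  exists (\bigcap_i B i); split; first exact: borel_bigcap.
    by move=> x /Sg[q _ <-] i _; exact: SB.
  by move=> x /Af[a _ <-] aB; apply: (AB a) => // i; exact: aB.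
have [s ns|a na] :=
    tree_branch (P := fun s => ~ separated f g (boxA s) (boxS s)) nsep.
  apply/existsNP => sep; apply: ns.
  have boxA1 j c : (forall l, addr (size s) = Some (None, l) ->
      c `<=` VA l j) -> boxA s `&` c `<=` boxA (rcons s j).
    move=> cV q [qs qc] m l; rewrite size_rcons ltnS leq_eqVlt nth_rcons.
    case/predU1P => [->|ms] ml; first by rewrite ltnn eqxx; exact: (cV _ ml _ qc).
    by rewrite ms; exact: qs.
  have boxS1 i j c : (forall l, addr (size s) = Some (Some i, l) ->
      c `<=` VS l j) -> boxS s i `&` c `<=` boxS (rcons s j) i.
    move=> cV q [qs qc] m l; rewrite size_rcons ltnS leq_eqVlt nth_rcons.
    case/predU1P => [->|ms] ml; first by rewrite ltnn eqxx; exact: (cV _ ml _ qc).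
    by rewrite ms; exact: qs.
  case E : (addr (size s)) => [[[i|] l]|].
  - apply: (separated_splitS (i0 := i) (cVS l)) => j.
    apply: separatedS (sep j) => [q qs|k].
      by apply: (boxA1 j setT) => // l'; rewrite E.
    case: eqVneq => [->|ki]; first by apply: boxS1 => l'; rewrite E => -[<-].
    move=> q qs; apply: (boxS1 k j setT) => // l'; rewrite E => -[ik].
    by rewrite ik eqxx in ki.
  - apply: (separated_splitA (cVA l)) => j.
    apply: separatedS (sep j) => [|k q qs].
      by apply: boxA1 => l'; rewrite E => -[<-].
    by apply: (boxS1 k j setT) => // l'; rewrite E.
  - apply: separatedS (sep 0) => [q qs|k q qs].
      by apply: (boxA1 0 setT) => // l'; rewrite E.
    by apply: (boxS1 k 0 setT) => // l'; rewrite E.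
pose jA l := a (code None l).
pose jS i l := a (code (Some i) l).
have boxAP n : exists N, forall k, N <= k -> boxA (mkseq a k) `<=` cell VA jA n.
  exists (\max_(l < n) (code None l).+1) => k Nk q qa l ln.
  have pk : code None l < k.
    apply: leq_trans Nk; exact: (leq_bigmax (Ordinal ln)).
  by have := qa _ l _ (codeK _ _); rewrite size_mkseq nth_mkseq//; apply.
have boxSP i n : exists N, forall k, N <= k -> boxS (mkseq a k) i `<=` cell VS (jS i) n.
  exists (\max_(l < n) (code (Some i) l).+1) => k Nk q qa l ln.
  have pk : code (Some i) l < k.
    apply: leq_trans Nk; exact: (leq_bigmax (Ordinal ln)).
  by have := qa _ l _ (codeK _ _); rewrite size_mkseq nth_mkseq//; apply.
have [n|z Az zW] := limA jA.
  have [N /(_ _ (leqnn N)) sub] := boxAP n.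
  apply/set0P/eqP => cell0; apply: (na N).
  exists (fun=> setT); split => // [i|q /sub]; first exact: borelT.
  by rewrite cell0.
have /choice[w wP] : forall i, exists w, S w /\ (forall W, nbhs w W ->
    exists n, forall q, cell VS (jS i) n q -> W (g q)).
  move=> i; have [n|w Sw wW] := limS (jS i); last by exists w.
  have [N /(_ _ (leqnn N)) sub] := boxSP i n.
  apply/set0P/eqP => cell0; apply: (na N).
  exists (fun k => if k == i then set0 else setT); split.
  - by move=> k; case: ifP => _; [exact: borel0|exact: borelT].
  - by move=> k q; case: eqVneq => // ->; move=> /sub; rewrite cell0.
  - by move=> q _ /(_ i); rewrite eqxx.
have [i /eqP ziw] : exists i, z i <> w i.
  apply/existsNP => zw; apply: (indS z) => // i; rewrite zw; exact: (wP i).1.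
have := hX; rewrite open_hausdorff => /(_ _ _ ziw)[[G G'] /=].
rewrite !inE => -[zG wG'] [oG oG' GG'].
have [nA zn] := zW _ (ptws_eval_nbhs (open_nbhs_nbhs (conj oG zG))).
have [nS wn] := (wP i).2 _ (open_nbhs_nbhs (conj oG' wG')).
have [[NA subA] [NS subS]] := (boxAP nA, boxSP i nS).
case: (na (maxn NA NS)).
exists (fun k => if k == i then G' else setT); split.
- by move=> k; case: ifP => _; [exact: borel_open|exact: borelT].
- move=> k q; case: eqVneq => // ->.
  by move=> /(subS _ (leq_maxr _ _))/wn.
- move=> q /(subA _ (leq_maxl _ _))/zn/= Gq /(_ i); rewrite eqxx => G'q.
  by have : set0 (f q i) by rewrite -GG'.
Qed.

(** * Configurations *)

(** At level [n], [vertex h t] is meant for [size t = n], and [edge h k t] for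
    [k < n] and [size t = n - k.+1]; the other values are
    arbitrary. *)
Record config (X Y : Type) := Config {
  vertex : seq nat -> X;
  edge : nat -> seq nat -> Y
}.

(** The configuration of lower level that [h] induces on the sequences that end
    with [r]. *)
Definition suffix_config (X Y : Type) (h : config X Y) (r : seq nat) :=
  Config (fun t => vertex h (t ++ r)) (fun k t => edge h k (t ++ r)).

Lemma suffix_config_cat (X Y : Type) (h : config X Y) r r' :
  suffix_config (suffix_config h r') r = suffix_config h (r ++ r').
Proof.
by congr Config; do ?apply/funext => ?; rewrite /= catA.
Qed.

Definition join_config (X Y : Type) (h : nat -> config X Y) (y : Y) :=
  Config
    (fun t => if t is x :: s then vertex (h (last x s)) (belast x s)
              else vertex (h 0) [::])
    (fun k t => if t is x :: s then edge (h (last x s)) k (belast x s) else y).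

Lemma vertex_join (X Y : Type) (h : nat -> config X Y) y t i :
  vertex (join_config h y) (rcons t i) = vertex (h i) t.
Proof. by case: t => //= x s; rewrite last_rcons belast_rcons. Qed.

Lemma suffix_join (X Y : Type) (h : nat -> config X Y) y i :
  suffix_config (join_config h y) [:: i] = h i.
Proof.
rewrite /suffix_config; case E : (h i) => [v e]; congr Config.
  by apply/funext => t; rewrite cats1 vertex_join E.
apply/funext => k; apply/funext => -[|x s] /=; first by rewrite E.
by rewrite cats1 last_rcons belast_rcons E.
Qed.

Section largeness.
Context {X Y : topologicalType}.
Variables (f : Y -> X^ω).
Implicit Types (H : set (config X Y)) (h : config X Y).

Definition config_cvg (h_ : nat -> config X Y) h :=
  (forall t, (fun n => vertex (h_ n) t) @ \oo --> vertex h t) /\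
  (forall k t, (fun n => edge (h_ n) k t) @ \oo --> edge h k t).

Definition seq_closed H := forall (h_ : nat -> config X Y) h, config_cvg h_ h ->
  (forall n, H (h_ n)) -> H h.

(** The negation of this is the notion of largeness that drives the
    construction.  A small set only has to be covered by the Borel conditions,
    without being definable itself, so that smallness passes to arbitrary
    subsets. *)
Definition small n H := exists (t : nat -> seq nat) (B : nat -> set X),
  [/\ forall k, size (t k) = n,
      forall k, borel (B k) /\ independent (range f) (B k) &
      forall h, H h -> exists k, B k (vertex h (t k))].

Lemma independent0 (A : set (X^ω)) : independent A set0.
Proof. by move=> x _ /(_ 0). Qed.

Lemma small_bigcup (I : countType) n (H : I -> set (config X Y)) :
  (forall i, small n (H i)) -> small n (\bigcup_i H i).
Proof.
move=> /choice[t /choice[B tB]].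
pose addr m : option (I * nat) := unpickle m.
exists (fun m => if addr m is Some (i, k) then t i k else nseq n 0).
exists (fun m => if addr m is Some (i, k) then B i k else set0); split.
- move=> k; case: (addr k) => [[i m]|]; last exact: size_nseq.
  by case: (tB i).
- move=> k; case: (addr k) => [[i m]|]; first by case: (tB i).
  by split; [exact: borel0|exact: independent0].
- move=> h [i _ hi]; case: (tB i) => _ _ /(_ h hi)[k hk].
  by exists (pickle (i, k)); rewrite /addr pickleK.
Qed.

Lemma small_sub n H H' : H `<=` H' -> small n H' -> small n H.
Proof.
by move=> HH' [t [B [st iB tB]]]; exists t, B; split => // h /HH'/tB.
Qed.

Lemma small0 n : small n set0.
Proof.
exists (fun=> nseq n 0), (fun=> set0); split => // k; first exact: size_nseq.
by split; [exact: borel0|exact: independent0].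
Qed.

Lemma large_nonempty n H : ~ small n H -> H !=set0.
Proof. by move=> nH; apply/set0P/eqP => H0; apply: nH; rewrite H0; exact: small0. Qed.

(** The configurations of level [n.+1] obtained by joining members of [H], one
    for each last entry [i], along a new edge at [s_omega n]. *)
Definition extend n H := [set h | (forall i, H (suffix_config h [:: i])) /\
  forall i, f (edge h n [::]) i = vertex h (rcons (s_omega n) i)].

Hypotheses (hX : hausdorff_space X) (cf : continuous f).

Lemma ptws_eval_cvg (x_ : nat -> X^ω) (x : X^ω) i :
  x_ @ \oo --> x -> (fun n => x_ n i) @ \oo --> x i.
Proof. by move=> xx W /ptws_eval_nbhs/xx. Qed.

Lemma edge_cvg (y_ : nat -> Y) y i :
  y_ @ \oo --> y -> (fun n => f (y_ n) i) @ \oo --> f y i.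
Proof.
move=> yy.
have : (f \o y_) @ \oo --> f y.
  by apply: cvg_comp yy _; exact: cf.
exact: ptws_eval_cvg.
Qed.

Lemma seq_closed_extend n H : seq_closed H -> seq_closed (extend n H).
Proof.
move=> cH h_ h [cv ce] Hh; split => i.
  apply: (cH (fun n => suffix_config (h_ n) [:: i])) => [|m]; last exact: (Hh m).1.
  by split => [t|k t]; [exact: cv|exact: ce].
have := edge_cvg (i := i) (ce n [::]).
under eq_fun do rewrite (Hh _).2.
by move=> fl; exact: (cvg_unique hX fl (cv _)).
Qed.

Variables (UX : nat -> nat -> set X) (UY : nat -> nat -> set Y).
Hypotheses (sX : complete_sieve UX) (sY : complete_sieve UY).

(** The configurations avoiding the sets [B k] are coded by a vertex for each
    sequence, an edge for each index and tail, and a witness that the vertex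
    [t k] is outside [B k] ([borel_projective]).  These are countably many
    coordinates, so the covers of the factors make up one sequence of covers. *)
Lemma souslin_vertex H (t : nat -> seq nat) (B : nat -> set X) (s : seq nat) :
  seq_closed H -> (forall k, borel (B k)) ->
  souslin [set x | exists h,
    [/\ H h, forall k, ~ B k (vertex h (t k)) & x = vertex h s]].
Proof.
move=> cH bB.
have /choice[C /all_and2[cC BC]] : forall k, projective (~` B k).
  by move=> k; apply: (borel_projective sX); exact: borelC.
pose Q := {p : config X Y * (nat -> nat -> nat) |
  H p.1 /\ forall k, C k (vertex p.1 (t k)) (p.2 k)}.
pose coord := (seq nat + nat * seq nat + nat * nat)%type.
pose addr m : option (coord * nat) := unpickle m.
pose code (c : coord) (l : nat) := pickle (c, l).
have codeK c l : addr (code c l) = Some (c, l) by exact: pickleK.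
pose V m j : set Q := fun q => match addr m with
  | Some (inl (inl t), l) => UX l j (vertex (sval q).1 t)
  | Some (inl (inr (k, t)), l) => UY l j (edge (sval q).1 k t)
  | Some (inr (k, i), _) => (sval q).2 k i = j
  | None => True end.
exists Q, (fun q => vertex (sval q).1 s), V; split.
- move=> _ [h [Hh hB ->]].
  have /choice[y yC] k : exists y, C k (vertex h (t k)) y by apply/BC/hB.
  by exists (exist _ (h, y) (conj Hh yC)).
- move=> m q; rewrite /V; case: (addr m) => [[[[t'|[k t']]|[k i]] l]|].
  + exact: sieve_cover sX _ _.
  + exact: sieve_cover sY _ _.
  + by eexists.
  + by exists 0.
move=> j /choice[q qj].
have near_V c l : \forall n \near \oo, V (code c l) (j (code c l)) (q n).
  by apply: filterS (nbhs_infty_gt (code c l)) => n; exact: qj.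
have vP t' : exists2 x, forall l, UX l (j (code (inl (inl t')) l)) x &
    (fun n => vertex (sval (q n)).1 t') @ \oo --> x.
  apply: (sieve_cvg sX) => l; apply: filterS (near_V (inl (inl t')) l) => n.
  by rewrite /V codeK.
have eP p : exists2 y, forall l, UY l (j (code (inl (inr p)) l)) y &
    (fun n => edge (sval (q n)).1 p.1 p.2) @ \oo --> y.
  apply: (sieve_cvg sY) => l; apply: filterS (near_V (inl (inr p)) l) => n.
  by rewrite /V codeK; case: (p).
have /choice[v /all_and2[vU vcvg]] : forall t, exists x,
    (forall l, UX l (j (code (inl (inl t)) l)) x) /\
    (fun n => vertex (sval (q n)).1 t) @ \oo --> x.
  by move=> t'; have [x] := vP t'; exists x.
have /choice[e ecvg] : forall p : nat * seq nat, exists y : Y,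
    (fun n => edge (sval (q n)).1 p.1 p.2) @ \oo --> y.
  by move=> p; have [y] := eP p; exists y.
pose h := Config v (fun k t => e (k, t)).
pose y k i := j (code (inr (k, i)) 0).
have qh : config_cvg (fun n => (sval (q n)).1) h.
  by split => // k t'; exact: (ecvg (k, t')).
exists (v s).
  exists h; split => //; first by apply: cH qh _ => n; have [] := svalP (q n).
  move=> k; apply/BC; exists (y k).
  apply: (cC _ _ _ (fun n => (sval (q n)).2 k) _ (vcvg (t k))).
    move=> i; apply: filterS (near_V (inr (k, i)) 0) => n.
    by rewrite /V codeK.
  by apply: nearW => n; have [_] := svalP (q n).
move=> W /(sieve_nbhs sX (vU s))[n nW].
exists (\max_(l < n) (code (inl (inl s)) l).+1) => p pj; apply: nW => l ln.
have := pj (code (inl (inl s)) l); rewrite /V codeK; apply.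
exact: (leq_bigmax (Ordinal ln)).
Qed.

Hypothesis sA : souslin (range f).

(** Smallness is defined with Borel sets, while members of [H] can be joined as
    soon as their places for [s_omega n] form a set that is not independent.
    The Borel hull connects the two notions. *)
Lemma extend_large n H : seq_closed H -> ~ small n H -> ~ small n.+1 (extend n H).
Proof.
move=> cH nH [t [B [st iB tB]]].
(* Level [n.+1] vertices are split into their level [n] part and the last entry. *)
have tE k : rcons (take n (t k)) (last 0 (t k)) = t k.
  move: (st k); case/lastP: (t k) => // s i; rewrite size_rcons => -[<-].
  by rewrite last_rcons -(cats1 s i) take_size_cat// cats1.
pose t' k := take n (t k).
pose S := [set x | exists h,
  [/\ H h, forall k, ~ B k (vertex h (t' k)) & x = vertex h (s_omega n)]].
have [indS|] := pselect (independent (range f) S).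
  have sS : souslin S by apply: souslin_vertex => // k; case: (iB k).
  have [B' [bB' SB' iB']] := independent_borel_hull hX sA sS indS.
  apply: nH; exists (fun k => if k is k'.+1 then t' k' else s_omega n).
  exists (fun k => if k is k'.+1 then B k' else B'); split.
  - case=> [|k]; first exact: size_s_omega.
    by rewrite size_takel// st.
  - by case=> [|k]; [split|exact: iB].
  - move=> h Hh; have [[k hk]|/forallNP hB] :=
        pselect (exists k, B k (vertex h (t' k))).
      by exists k.+1.
    by exists 0; apply: SB'; exists h.
move=> /existsNP[_ /not_implyP[[y _ <-] /notP/choice[h hP]]].
have [|k] := tB (join_config h y).
  split=> i; first by rewrite suffix_join; case: (hP i).
  by rewrite vertex_join; case: (hP i) => _ _ <-.
rewrite -tE vertex_join; have [_ + _] := hP (last 0 (t k)); exact.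
Qed.

Let index := (seq nat * seq (seq nat))%type.

(** The vertex [rcons (s_omega n) 0] and the edges that contain it are in
    prescribed pieces of the first [n.+1] covers: an edge that contains this
    vertex is [edge h k] at its [drop k.+1], for some [k <= n]. *)
Definition piece n (a : index) := [set h : config X Y |
  (forall m, m <= n ->
     UX m (nth 0 a.1 m) (vertex h (rcons (s_omega n) 0))) /\
  (forall k m, k <= n -> m <= n ->
     UY m (nth 0 (nth [::] a.2 k) m)
       (edge h k (drop k.+1 (rcons (s_omega n) 0))))].

Lemma seq_closed_piece n a : seq_closed (piece n a).
Proof.
move=> h_ h [cv ce] Hh; split => [m mn|k m kn mn].
  apply: (closed_cvg _ (@sieve_closed _ _ sX _ _) _ _ (cv _)).
  by apply: nearW => i; exact: (Hh i).1.
apply: (closed_cvg _ (@sieve_closed _ _ sY _ _) _ _ (ce _ _)).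
by apply: nearW => i; exact: (Hh i).2.
Qed.

Lemma piece_cover n h : exists a, piece n a h.
Proof.
have [v vP] := choice (fun m => sieve_cover sX m (vertex h (rcons (s_omega n) 0))).
have [e eP] := choice (fun km : nat * nat => sieve_cover sY km.2
  (edge h km.1 (drop km.1.+1 (rcons (s_omega n) 0)))).
exists (mkseq v n.+1, mkseq (fun k => mkseq (fun m => e (k, m)) n.+1) n.+1).
split => [m mn|k m kn mn]; rewrite !nth_mkseq//; exact: (eP (k, m)).
Qed.

Fixpoint stage (a : nat -> index) n : set (config X Y) :=
  if n is m.+1 then extend m (stage a m) `&` piece m (a m) else setT.

Lemma eq_stage a b n : (forall m, m < n -> a m = b m) -> stage a n = stage b n.
Proof.
by elim: n => //= n IHn ab; rewrite ab// IHn// => m mn; rewrite ab// ltnW.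
Qed.

Lemma seq_closed_stage a n : seq_closed (stage a n).
Proof.
elim: n => //= n IHn h_ h hh Hh; split.
  by apply: seq_closed_extend hh _ => // m; case: (Hh m).
by apply: seq_closed_piece hh _ => m; case: (Hh m).
Qed.

Lemma large_stage : ~ small 0 setT -> exists a, forall n, ~ small n (stage a n).
Proof.
move=> nT; pose a0 : index := ([::], [::]).
pose P s := ~ small (size s) (stage (nth a0 s) (size s)).
have [s|a na] := tree_branch (P := P) nT.
  move=> ns; apply/existsNP => sm.
  apply: (extend_large (@seq_closed_stage (nth a0 s) _) ns).
  suff : small (size s).+1
      (\bigcup_a (extend (size s) (stage (nth a0 s) (size s)) `&` piece (size s) a)).
    apply: small_sub => h hs; have [a ha] := piece_cover (size s) h.
    by exists a.
  apply: small_bigcup => j; have := sm j; rewrite /P size_rcons /=.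
  rewrite nth_rcons ltnn eqxx (eq_stage (b := nth a0 s))// => m ms.
  by rewrite nth_rcons ms.
exists a => n; have := na n; rewrite /P size_mkseq (eq_stage (b := a))// => m mn.
by rewrite nth_mkseq.
Qed.

Lemma stage_suffix a n h r :
  stage a (n + size r) h -> stage a n (suffix_config h r).
Proof.
elim/last_ind: r h => [|r i IHr] h.
  rewrite addn0; case: h => v e; congr (stage a n _).
  by congr Config; do ?apply/funext => ?; rewrite /= cats0.
rewrite size_rcons addnS => -[[/(_ i)/IHr + _] _].
by rewrite suffix_config_cat cats1.
Qed.
End largeness.

(** * The limit homomorphism *)

Lemma cylinder_nbhs (a : nat^ω) (n : nat) :
  nbhs a [set b : nat^ω | mkseq b n = mkseq a n].
Proof.
elim: n => [|n IHn]; first exact: filterS filterT.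
have := ptws_eval_nbhs (x := a) (i := n) (discrete_set1 (a n)).
by apply: filterS2 IHn => b /= ban bn; rewrite !mkseqS ban bn.
Qed.

Lemma ptws_nat_cvg (a_ : nat -> nat^ω) (a : nat^ω) :
  (forall i, \forall n \near \oo, a_ n i = a i) -> a_ @ \oo --> a.
Proof.
move=> aa; apply/cvg_sup => i W; rewrite nbhsE => -[_ [[V oV <-] Va] VW].
by apply: filterS (aa i) => n an; apply: VW; rewrite /= an.
Qed.

Lemma nbhs_cylinder (a : nat^ω) (W : set (nat^ω)) : nbhs a W ->
  exists n, forall b : nat^ω, mkseq b n = mkseq a n -> W b.
Proof.
move=> aW; apply: contrapT => /forallNP noW.
have /choice[b bP] : forall n, exists b : nat^ω, mkseq b n = mkseq a n /\ ~ W b.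
  by move=> n; have /existsNP[b /not_implyP[]] := noW n; exists b.
have /(_ W aW)[N _ /(_ N (leqnn N))] : b @ \oo --> a.
  apply: ptws_nat_cvg => i; exists i.+1 => // n /= ni.
  by have := congr1 (nth 0 ^~ i) (bP n).1; rewrite !nth_mkseq.
by case: (bP N).
Qed.

Lemma nbhs_sub_cylinder (G : set (nat^ω)) (g : set_type G) (n : nat) :
  nbhs g [set g' : set_type G | mkseq (set_val g') n = mkseq (set_val g) n].
Proof.
exact: (@initial_continuous _ _ (@set_val _ G) g _ (cylinder_nbhs _ n)).
Qed.

Lemma mkseq_prefix (s : seq nat) (a : nat -> nat) :
  prefix_omega s a <-> mkseq a (size s) = s.
Proof.
split=> [sa|<- k ks]; last by rewrite nth_mkseq// -(size_mkseq a (size s)).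
apply: (@eq_from_nth _ 0); rewrite size_mkseq// => k ks.
by rewrite nth_mkseq// sa.
Qed.

Lemma mkseq_cat (a : nat -> nat) m n :
  m <= n -> mkseq a n = mkseq a m ++ drop m (mkseq a n).
Proof.
move=> mn; rewrite -[LHS](cat_take_drop m); congr (_ ++ _).
apply: (@eq_from_nth _ 0) => [|i im].
  by rewrite size_takel size_mkseq.
rewrite size_takel ?size_mkseq// in im.
by rewrite nth_take// !nth_mkseq// (leq_trans im).
Qed.

Lemma mkseq_cat_omega (s : seq nat) (c : nat^ω) n :
  size s <= n -> mkseq (cat_omega s c) n = s ++ mkseq c (n - size s).
Proof.
move=> sn; apply: (@eq_from_nth _ 0) => [|i].
  by rewrite size_cat !size_mkseq subnKC.
rewrite size_mkseq => ilt; rewrite nth_mkseq// nth_cat /cat_omega.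
by case: ltnP => // si; rewrite nth_mkseq// ltn_sub2r// (leq_ltn_trans si).
Qed.

Section limit.
Context {X Y : topologicalType}.
Variables (f : Y -> X^ω) (UX : nat -> nat -> set X) (UY : nat -> nat -> set Y).
Hypotheses (hX : hausdorff_space X) (cf : continuous f).
Hypotheses (sX : complete_sieve UX) (sY : complete_sieve UY).
Variables (a : nat -> seq nat * seq (seq nat)) (h : nat -> config X Y).
Hypothesis ha : forall n, stage f UX UY a n (h n).

Let stage_tail p (s r : seq nat) : size s = p ->
  stage f UX UY a p (suffix_config (h (size (s ++ r))) r).
Proof. by move=> <-; apply: stage_suffix; rewrite -size_cat; exact: ha. Qed.

Let piece_tail p q (al : nat -> nat) :
  prefix_omega (rcons (s_omega p) 0) al -> p < q ->
  piece UX UY p (a p) (suffix_config (h q) (drop p.+1 (mkseq al q))).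
Proof.
move=> /mkseq_prefix; rewrite size_rcons size_s_omega => pal pq.
have := stage_tail (drop p.+1 (mkseq al q)) (size_mkseq al p.+1).
by rewrite -mkseq_cat// size_mkseq => -[].
Qed.

Let vertex_tail p q m al : prefix_omega (rcons (s_omega p) 0) al ->
  p < q -> m <= p -> UX m (nth 0 (a p).1 m) (vertex (h q) (mkseq al q)).
Proof.
move=> pal pq mp; have [/(_ m mp) + _] := piece_tail pal pq.
move: pal => /mkseq_prefix; rewrite size_rcons size_s_omega => pal.
by rewrite /= -pal -mkseq_cat.
Qed.

Let edge_tail p q k m al : prefix_omega (rcons (s_omega p) 0) al ->
  p < q -> k <= p -> m <= p ->
  UY m (nth 0 (nth [::] (a p).2 k) m) (edge (h q) k (drop k.+1 (mkseq al q))).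
Proof.
move=> pal pq kp mp; have [_ /(_ k m kp mp)] := piece_tail pal pq.
move: pal => /mkseq_prefix; rewrite size_rcons size_s_omega => pal.
suff -> : drop k.+1 (mkseq al q) =
    drop k.+1 (mkseq al p.+1) ++ drop p.+1 (mkseq al q) by rewrite pal.
rewrite {1}(mkseq_cat al pq) drop_cat size_mkseq ltnS.
case: ltnP => // pk; have -> : k = p by apply/eqP; rewrite eqn_leq kp.
by rewrite subnn drop0 (drop_oversize (s := mkseq al p.+1)) ?size_mkseq.
Qed.

Let hyperedge n q (c : nat^ω) i : n < q ->
  f (edge (h q) n (mkseq c (q - n.+1))) i =
  vertex (h q) (mkseq (cat_omega (rcons (s_omega n) i) c) q).
Proof.
move=> nq; have sz : size (rcons (s_omega n) i) = n.+1.
  by rewrite size_rcons size_s_omega.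
rewrite mkseq_cat_omega sz//.
have := stage_tail (mkseq c (q - n.+1)) sz.
by rewrite size_cat sz size_mkseq subnKC// => -[[_ /(_ i)]].
Qed.

Let G_prefix (g : set_type G_omega) m :
  exists p, m <= p /\ prefix_omega (rcons (s_omega p) 0) (set_val g).
Proof. by have /set_mem/(_ m)[p] := svalP g; exists p. Qed.

Let limit_exists (g : set_type G_omega) : exists x : X,
  (fun q => vertex (h q) (mkseq (set_val g) q)) @ \oo --> x.
Proof.
have [p /all_and2[mp pg]] := choice (G_prefix g).
have [|x _ xP] := sieve_cvg sX (j := fun m => nth 0 (a (p m)).1 m)
  (u := fun q => vertex (h q) (mkseq (set_val g) q)); last by exists x.
by move=> m; exists (p m).+1 => // q /= pq; exact: vertex_tail.
Qed.

(** The image of [al] in [G_omega] is the limit of the places of its initial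
    segments in [h q].  Each [p] with [s_omega p ++ 0] an initial segment of [al]
    fixes, for all [q > p], a piece of each of the first [p.+1] covers, which
    gives convergence and continuity.  For an element of [A_omega_G] based on
    [s_omega n], the edges [edge h n] along the common tail converge as well,
    because one of their vertices is in [G_omega]; by continuity [f] maps their
    limit to the sequence of the images of the vertices. *)
Lemma stages_homomorphism : continuous_le A_omega_G (range f).
Proof.
have [u uP] := choice limit_exists.
exists u; split.
  move=> g W ugW; have [p /all_and2[mp pg]] := choice (G_prefix g).
  have near_g (g' : set_type G_omega) m :
      prefix_omega (rcons (s_omega (p m)) 0) (set_val g') ->
      UX m (nth 0 (a (p m)).1 m) (u g').
    move=> pg'; apply: (closed_cvg _ (@sieve_closed _ _ sX _ _) _ _ (uP g')).
    by exists (p m).+1 => // q /= pq; exact: vertex_tail.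
  have [n nW] := sieve_nbhs sX (fun m => near_g g m (pg m)) ugW.
  apply: filterS (nbhs_sub_cylinder g (\max_(m < n) (p m).+1)) => g' /= gg'.
  apply: nW => m mn; apply: near_g => k; rewrite size_rcons size_s_omega => kp.
  have kn : k < \max_(m < n) (p m).+1.
    by apply: leq_trans kp _; exact: (leq_bigmax (Ordinal mn)).
  rewrite (pg m) ?size_rcons ?size_s_omega//.
  by have := congr1 (nth 0 ^~ k) gg'; rewrite !nth_mkseq.
move=> x [n [c xE]]; have xiE i : set_val (x i) = cat_omega (rcons (s_omega n) i) c.
  exact: (congr1 (fun z => z i) xE).
have /choice[p pP] : forall m, exists p, [/\ n <= p, m <= p &
    prefix_omega (rcons (s_omega p) 0) (set_val (x 0))].
  move=> m; have [p [mp px]] := G_prefix (x 0) (maxn n m).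
  by exists p; move: mp; rewrite geq_max => /andP[].
have [|y _ yP] := sieve_cvg sY (j := fun m => nth 0 (nth [::] (a (p m)).2 n) m)
    (u := fun q => edge (h q) n (mkseq c (q - n.+1))).
  move=> m; have [np mp px] := pP m; exists (p m).+1 => // q /= pq.
  have := edge_tail px pq np mp.
  have sz : size (rcons (s_omega n) 0) = n.+1 by rewrite size_rcons size_s_omega.
  by rewrite xiE mkseq_cat_omega sz ?drop_size_cat// (leq_ltn_trans np).
exists y => //; apply/funext => i; apply: (cvg_unique hX (edge_cvg cf (i := i) yP)).
apply: cvg_trans (uP (x i)); apply: near_eq_cvg.
exists n.+1 => // q /= nq; rewrite hyperedge// -xiE//.
Qed.
End limit.

(** The constant configurations show that the sets [B k] of a small cover at
    level 0 cover [X]; colour a point by the first one that contains it. *)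
Lemma small_coloring (X Y : topologicalType) (f : Y -> X^ω) (y0 : Y) :
  small f 0 setT -> borel_le (range f) (~` @diag_omega nat).
Proof.
move=> [t [B [st iB tB]]].
have cB x : exists k, `[< B k x >].
  have [k] := tB (Config (fun=> x) (fun _ _ => y0)) I.
  by move=> Bk; exists k; apply/asboolP.
pose u x := ex_minn (cB x).
have Bu x : B (u x) x by rewrite /u; case: ex_minnP => k /asboolP.
have uB x k : B k x -> u x <= k.
  by rewrite /u; case: ex_minnP => m _ mk /asboolP/mk.
exists u; split.
  have bu k : borel [set x | u x = k].
    rewrite (_ : mkset _ = \bigcap_j (if j < k then ~` B j else
        if j == k then B k else setT)).
      apply: borel_bigcap => j; case: ifP => _; first by apply: borelC; case: (iB j).
      by case: ifP => _; [exact: (iB k).1|exact: borelT].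
    apply/seteqP; split=> [x <- j _|x xB].
      case: ltnP => [jx /uB|_]; first by rewrite leqNgt jx.
      by case: eqVneq => // _; exact: Bu.
    have := xB k I; rewrite ltnn eqxx => /uB; rewrite leq_eqVlt.
    case/predU1P => // uk; have := xB (u x) I; rewrite uk => /(_ (Bu x)) [].
  move=> E _; rewrite (_ : _ @^-1` _ =
      \bigcup_k (if pselect (E k) then [set x | u x = k] else set0)).
    by apply: borel_bigcup => k; case: pselect => ? /=; [exact: bu|exact: borel0].
  apply/seteqP; split=> [x Ex|x [k _]]; last first.
    by case: pselect => // Ek xk; rewrite /preimage/= xk.
  by exists (u x) => //; case: pselect.
move=> x Ax /= xu; apply: ((iB (u (x 0))).2 x Ax) => i.
by have <- : u (x i) = u (x 0) := xu i; exact: Bu.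
Qed.

Theorem coloring_or_homomorphism (R : realType) (X : topologicalType)
    (A : set (X^ω)) :
  polish R X -> analytic R A ->
  borel_le A (~` @diag_omega nat) \/ continuous_le A_omega_G A.
Proof.
move=> polX anA; have sA := analytic_souslin anA.
case: anA => Y [f [polY cf fA]]; rewrite -fA in sA *.
have [[y0 _]|noY] := pselect ([set: Y] !=set0); last first.
  left; exists (fun=> 0); split => [E _|x [y _ _]]; last by case: noY; exists y.
  have [E0|E0] := pselect (E 0).
    by rewrite (_ : _ @^-1` _ = setT) ?eqEsubset; [exact: borelT|split].
  by rewrite (_ : _ @^-1` _ = set0) ?eqEsubset; [exact: borel0|split].
have [/(small_coloring y0)|large] := pselect (small f 0 setT); first by left.
right; have [UX sX] := polish_sieve polX; have [UY sY] := polish_sieve polY.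
have hX := polish_hausdorff polX.
have [a na] := large_stage hX cf sX sY sA large.
have /choice[h hP] n := large_nonempty (na n).
exact: stages_homomorphism hX cf sX sY a h hP.
Qed.

(** * Baire category *)

(** Comeager in the basic open set given by [s]: [E] contains the intersection
    of that set with countably many dense open sets, the [k]-th one being given
    by the finite sequences in [D k]. *)
Definition comeager (s : seq nat) (E : set (nat^ω)) :=
  exists D : nat -> seq nat -> Prop,
    (forall k t, exists t', D k (s ++ t ++ t')) /\
    forall a : nat^ω, mkseq a (size s) = s ->
      (forall k, exists n, D k (mkseq a n)) -> E a.

Lemma comeager_sub s (E E' : set (nat^ω)) :
  E `<=` E' -> comeager s E -> comeager s E'.
Proof. by move=> EE' [D [dD DE]]; exists D; split => // a sa /(DE a sa)/EE'. Qed.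

Lemma comeagerT s (E : set (nat^ω)) :
  (forall a : nat^ω, mkseq a (size s) = s -> E a) -> comeager s E.
Proof.
by move=> sE; exists (fun _ _ => True); split => [k t|a /sE]; [exists [::]|].
Qed.

Lemma comeager_bigcap s (E : nat -> set (nat^ω)) :
  (forall i, comeager s (E i)) -> comeager s (\bigcap_i E i).
Proof.
move=> /choice[D DP].
pose addr m : option (nat * nat) := unpickle m.
exists (fun m r => if addr m is Some (i, k) then D i k r else True); split.
  move=> m t; case: (addr m) => [[i k]|]; last by exists [::].
  by case: (DP i) => + _; exact.
move=> a sa aD i _; case: (DP i) => _; apply => // k.
by have [n] := aD (pickle (i, k)); rewrite /addr pickleK; exists n.
Qed.

Lemma comeagerI s (E E' : set (nat^ω)) :
  comeager s E -> comeager s E' -> comeager s (E `&` E').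
Proof.
move=> cE cE'; have : comeager s (\bigcap_i (if i == 0 then E else E')).
  by apply: comeager_bigcap => i; case: ifP.
by apply: comeager_sub => a aE; split; [exact: (aE 0)|exact: (aE 1)].
Qed.

Lemma mkseq_catl (a : nat -> nat) s t :
  mkseq a (size (s ++ t)) = s ++ t -> mkseq a (size s) = s.
Proof.
move=> ast; rewrite -[RHS](take_size_cat t (erefl (size s))) -ast.
have sst : size s <= size (s ++ t) by rewrite size_cat leq_addr.
by rewrite (mkseq_cat a sst) take_size_cat ?size_mkseq.
Qed.

Lemma comeager_cat s t (E : set (nat^ω)) : comeager s E -> comeager (s ++ t) E.
Proof.
move=> [D [dD DE]]; exists D; split => [k t0|a /mkseq_catl]; last exact: DE.
by have [t' Dt] := dD k (t ++ t0); exists t'; rewrite -!catA in Dt *.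
Qed.

(** The digit 0 added at each step makes the lengths unbounded. *)
Lemma baire s (E : set (nat^ω)) : comeager s E -> E !=set0.
Proof.
move=> [D [dD DE]].
have /choice[e eP] : forall kr : nat * seq nat, exists t,
    prefix s kr.2 -> D kr.1 (kr.2 ++ 0 :: t).
  move=> [k r] /=; have [/prefixP[t ->]|] := boolP (prefix s r); last by exists [::].
  by have [t' Dt] := dD k (rcons t 0); exists t' => _;
    rewrite cat_rcons in Dt; rewrite -catA.
pose st := fix st l := if l is m.+1 then st m ++ 0 :: e (m, st m) else s.
have stS (k n : nat) : exists t, st (k + n) = st k ++ t.
  elim: n => [|n [t IHn]]; first by exists [::]; rewrite addn0 cats0.
  by rewrite addnS /= IHn; eexists; rewrite -catA.
have st_size (k : nat) : k <= size (st k).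
  by elim: k => //= k IHk; rewrite size_cat /= addnS ltnS (leq_trans IHk)// leq_addr.
pose a i := nth 0 (st i.+1) i.
have aP j : mkseq a (size (st j)) = st j.
  apply: (@eq_from_nth _ 0); rewrite size_mkseq// => i ij; rewrite nth_mkseq// /a.
  have [ji|ij'] := leqP j i.+1.
    by have [t] := stS j (i.+1 - j); rewrite subnKC// => ->; rewrite nth_cat ij.
  have [t] := stS i.+1 (j - i.+1); rewrite subnKC ?(ltnW ij')// => ->.
  by rewrite nth_cat st_size.
exists a; apply: DE; first exact: (aP 0).
move=> k; exists (size (st k.+1)); rewrite aP; apply: (eP (k, st k)) => /=.
by have [t ->] := stS 0 k; exact: prefix_prefix.
Qed.

(** The dense sets chosen for different initial segments of a point must not be
    mixed: each point uses only those of its shortest initial segment in which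
    [E] is comeager. *)
Lemma comeager_local s (E : set (nat^ω)) :
  (forall t, exists t', comeager (s ++ t ++ t') E) -> comeager s E.
Proof.
move=> sE.
have /choice[D DP] : forall r, exists D : nat -> seq nat -> Prop, comeager r E ->
    (forall k t, exists t', D k (r ++ t ++ t')) /\
    forall a : nat^ω, mkseq a (size r) = r ->
      (forall k, exists n, D k (mkseq a n)) -> E a.
  move=> r; have [[D ?]|nr] := pselect (comeager r E); first by exists D.
  by exists (fun _ _ => True) => /nr.
pose least m (r : seq nat) := [/\ m <= size r, comeager (take m r) E &
  forall m', m' < m -> ~ comeager (take m' r) E].
exists (fun k r => exists m, least m r /\ D (take m r) k r); split.
  move=> k t; have [t' cst] := sE t.
  have [r rE] : exists r, r = s ++ t ++ t' by eexists.
  rewrite -rE in cst.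
  have ex : exists m, (m <= size r) && `[< comeager (take m r) E >].
    by exists (size r); rewrite leqnn take_size; apply/asboolP.
  case: (ex_minnP ex) => m /andP[mr /asboolP cm] minm.
  have [+ _] := DP _ cm => /(_ k (drop m r))[t''].
  rewrite catA cat_take_drop => Dt; exists (t' ++ t''); exists m.
  have -> : s ++ t ++ t' ++ t'' = r ++ t'' by rewrite rE -!catA.
  rewrite !takel_cat//; split => //; split.
  - by rewrite size_cat (leq_trans mr)// leq_addr.
  - by rewrite takel_cat.
  - move=> m' m'm; rewrite takel_cat; last exact: leq_trans (ltnW m'm) mr.
    move=> cm'; have /minm : (m' <= size r) && `[< comeager (take m' r) E >].
      by rewrite (leq_trans (ltnW m'm) mr); apply/asboolP.
    by rewrite leqNgt m'm.
move=> a _ aD; have takea m n : m <= n -> take m (mkseq a n) = mkseq a m.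
  by move=> mn; rewrite (mkseq_cat a mn) take_size_cat// size_mkseq.
have {}aD k : exists m, [/\ comeager (mkseq a m) E,
    forall m', m' < m -> ~ comeager (mkseq a m') E &
    exists n, D (mkseq a m) k (mkseq a n)].
  have [n [m [[+ cm minm] Dm]]] := aD k; rewrite size_mkseq => mn.
  exists m; rewrite takea// in cm Dm; split => //; last by exists n.
  by move=> m' m'm; have := minm m' m'm; rewrite takea// (leq_trans (ltnW m'm)).
have [m [cm minm _]] := aD 0; have [_] := DP _ cm; apply; first by rewrite size_mkseq.
move=> k; have [m' [cm' minm' Dk]] := aD k.
case: (ltngtP m m') => [/minm'//|/minm//|-> //].
Qed.

Lemma comeager_shift s (E : set (nat^ω)) :
  comeager s E -> comeager [::] [set c | E (cat_omega s c)].
Proof.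
move=> [D [dD DE]]; exists (fun k r => D k (s ++ r)); split => [k t|c _ cD].
  exact: dD.
apply: DE; first by rewrite mkseq_cat_omega// subnn cats0.
move=> k; have [n Dn] := cD k; exists (size s + n).
by rewrite mkseq_cat_omega ?leq_addr// addKn.
Qed.

Lemma psi_omega_prefix r : exists n z, s_omega n = r ++ nseq z 0 /\ size r <= n.
Proof.
exists (code_rank (seq_code r)), (code_rank (seq_code r) - size r).
rewrite /s_omega nat_of_seqK; split => //.
by have := size_psi_omega (code_rank (seq_code r)); rewrite nat_of_seqK.
Qed.

Lemma comeager_G_omega : comeager [::] G_omega.
Proof.
exists (fun m r => exists2 n, m <= n & prefix (rcons (s_omega n) 0) r); split.
  move=> m t; have [n [z [sn mn]]] := psi_omega_prefix (t ++ nseq m 0).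
  exists (nseq m 0 ++ rcons (nseq z 0) 0); exists n.
    by apply: leq_trans mn; rewrite size_cat size_nseq leq_addl.
  by rewrite sn -!cats1 -!catA /=; exact: prefix_refl.
move=> a _ aD m; have [k [n mn /prefixP[r' akr]]] := aD m; exists n => //.
by apply/mkseq_prefix; apply: (@mkseq_catl _ _ r'); rewrite -akr size_mkseq.
Qed.

Section decided.
Variable G : set (nat^ω).
Implicit Types E : set (set_type G).

(** Points outside [G] are included, so that [ambient] commutes with countable
    intersections; [G] itself is intersected with at the end. *)
Definition ambient E : set (nat^ω) := [set a | forall g, set_val g = a -> E g].

(** The Baire property, in the form in which it is used: densely, the set or
    its complement is comeager. *)
Definition decided E := forall s, exists t,
  comeager (s ++ t) (ambient E) \/ comeager (s ++ t) (ambient (~` E)).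

Lemma decided_comeager E s : decided E ->
  (forall t, ~ comeager (s ++ t) (ambient E)) -> comeager s (ambient (~` E)).
Proof.
move=> dE nE; apply: comeager_local => t; have [t' cE] := dE (s ++ t).
by exists t'; move: cE; rewrite -catA => -[/nE|].
Qed.

Lemma decided_open E : open E -> decided E.
Proof.
move=> [V oV <-] s.
have [[t tV]|/forallNP noV] := pselect (exists t, forall a : nat^ω,
    mkseq a (size (s ++ t)) = s ++ t -> V a).
  by exists t; left; apply: comeagerT => a /tV Va g ga; rewrite /preimage/= ga.
exists [::]; right; apply: comeagerT => a; rewrite cats0 => sa g ga Vg.
have := @nbhs_cylinder a V; rewrite -ga => /(_ (open_nbhs_nbhs (conj oV Vg)))[n nV].
apply: (noV (drop (size s) (mkseq a n))) => b bs; apply: nV; rewrite ga.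
have [sn|ns] := leqP (size s) n.
  have := mkseq_cat a sn; rewrite sa => an; rewrite -an in bs.
  by rewrite size_mkseq in bs.
rewrite drop_oversize ?size_mkseq ?(ltnW ns)// cats0 -{2}sa in bs.
have := congr1 (take n) bs.
by rewrite (mkseq_cat b (ltnW ns)) (mkseq_cat a (ltnW ns)) !take_size_cat
  ?size_mkseq.
Qed.

Lemma decidedC E : decided E -> decided (~` E).
Proof.
move=> dE s; have [t tE] := dE s; exists t.
by rewrite setCK; case: tE; [right|left].
Qed.

Lemma decided_bigcup (F : nat -> set (set_type G)) :
  (forall i, decided (F i)) -> decided (\bigcup_i F i).
Proof.
move=> dF s.
have [[i [t it]]|none] := pselect (exists i t, comeager (s ++ t) (ambient (F i))).
  by exists t; left; apply: comeager_sub it => a aF g /aF Fg; exists i.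
exists [::]; right; rewrite cats0.
have : comeager s (\bigcap_i ambient (~` F i)).
  apply: comeager_bigcap => i; apply: decided_comeager => // t it.
  by apply: none; exists i, t.
by apply: comeager_sub => a aF g ga [i _ Fg]; exact: (aF i I g ga Fg).
Qed.
End decided.

Theorem not_coloring_and_homomorphism (X : topologicalType) (A : set (X^ω)) :
  ~ (borel_le A (~` @diag_omega nat) /\ continuous_le A_omega_G A).
Proof.
move=> [[v [bv Av]] [u [cu Au]]].
have dec c : decided [set g | v (u g) = c].
  have : borel (v @^-1` [set c]) by apply: bv; apply: borel_open; exact: discrete_open.
  apply: (borel_ind (P := fun B => decided (u @^-1` B))).
  - by move=> B oB; apply: decided_open; apply: open_comp => // ? _; exact: cu.
  - by move=> B; exact: decidedC.
  - by move=> F dF; rewrite preimage_bigcup; exact: decided_bigcup.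
(* Otherwise all colour classes would be meager in [G_omega]. *)
have [c [t ct]] : exists c t, comeager t (ambient [set g | v (u g) = c]).
  apply: contrapT => none.
  have : comeager [::] (\bigcap_c ambient (~` [set g | v (u g) = c])).
    apply: comeager_bigcap => c; apply: decided_comeager => // t ct.
    by apply: none; exists c, t.
  move=> /comeagerI/(_ comeager_G_omega)/baire[a [aE /mem_set Ga]].
  exact: (aE (v (u (exist _ a Ga))) I (exist _ a Ga) erefl).
have [n [z [nt _]]] := psi_omega_prefix t.
have : comeager [::] (\bigcap_i [set b |
    (ambient [set g | v (u g) = c] `&` G_omega) (cat_omega (rcons (s_omega n) i) b)]).
  apply: comeager_bigcap => i; apply: comeager_shift; apply: comeagerI.
    by rewrite nt -cats1 -catA; exact: comeager_cat.
  exact: (comeager_cat (rcons (s_omega n) i) comeager_G_omega).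
move=> /baire[b bP].
have /choice[x xP] : forall i, exists g : set_type G_omega,
    set_val g = cat_omega (rcons (s_omega n) i) b /\ v (u g) = c.
  move=> i; have [vE /mem_set Gi] := bP i I.
  pose g : set_type G_omega := exist (fun a => a \in G_omega) _ Gi.
  by exists g; split => //; exact: vE.
have xA : A_omega_G x by exists n, b; apply/funext => i; exact: (xP i).1.
apply: (Av _ (Au _ xA)) => i; rewrite /map_omega.
by rewrite (xP i).2 (xP 0).2.
Qed.

Theorem theorem1p6 (R : realType) (X : topologicalType) (A : set (X^ω)) :
  polish R X -> analytic R A ->
  (borel_le A (~` @diag_omega nat) \/ continuous_le A_omega_G A) /\
  ~ (borel_le A (~` @diag_omega nat) /\ continuous_le A_omega_G A).
Proof.
move=> polX anA; split; first exact: coloring_or_homomorphism polX anA.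
exact: not_coloring_and_homomorphism.
Qed.
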